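(* Let $p_1>3$ be a prime with $p_1\equiv 3 \pmod 4$, let $m\geq 1$ be an integer, and put $N=p_1^m$. Let $p$ be a prime with $\gcd(p,N)=1$ and $f:=\mathrm{ord}_N(p)=\phi(N)/2$. Let $q=p^f$, let $\gamma$ be a primitive element of $\mathbb{F}_q$, let $C_0=\langle \gamma^N\rangle$ and $C_i=\gamma^i C_0$ for $i\in\mathbb{Z}$ (indices taken modulo $N$). For $0\leq k\leq p_1-1$ define $$D_k=\bigcup_{i=0}^{p_1^{m-1}-1} C_{i+kp_1^{m-1}}.$$ Define $R'_0=\{(x,x)\mid x\in\mathbb{F}_q\}$ and, for $1\leq k\leq p_1$, $R'_k=\{(x,y)\mid x,y\in\mathbb{F}_q,\ x-y\in D_{k-1}\}$. Then $(\mathbb{F}_q,\{R'_k\}_{0\leq k\leq p_1})$ is a pseudocyclic association scheme.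
   Context: An association scheme with $d$ classes on a finite set $X$ is a partition $R_0=\{(x,x)\},R_1,\dots,R_d$ of $X\times X$ such that each $R_i$ is symmetric and, for all $i,j,k$, the number of $z$ with $(x,z)\in R_i$, $(z,y)\in R_j$ depends only on $k$ where $(x,y)\in R_k$ (here all schemes are commutative and symmetric). Let $E_0=\frac{1}{|X|}J,E_1,\dots,E_d$ be the primitive idempotents of its Bose–Mesner algebra (the algebra spanned by the adjacency matrices of the $R_i$). The scheme is pseudocyclic if there is an integer $t$ with $\mathrm{rank}(E_i)=t$ for all $1\leq i\leq d$. $\mathrm{ord}_n(p)$ denotes the multiplicative order of $p$ modulo $n$ and $\phi$ is Euler's totient function. *)

(* Defs.v *)
From HB Require Import structures.
From mathcomp Require Import all_boot all_order all_algebra all_fingroup all_solvable.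

Set Implicit Arguments.
Unset Strict Implicit.
Unset Printing Implicit Defensive.

Import GRing.Theory.
Local Open Scope ring_scope.

Section AssociationScheme.

Variables (X : finType) (d : nat) (R : 'I_d.+1 -> {set X * X}).

(* [injective R] makes this a partition indexed by 'I_d.+1: distinct indices
   give distinct, hence disjoint, blocks. *)
Definition association_scheme : Prop :=
  [/\ injective R /\ partition [set R i | i : 'I_d.+1] [set: X * X],
      R ord0 = [set (x, x) | x : X],
      forall i x y, (x, y) \in R i -> (y, x) \in R i
    & forall i j k, exists c : nat, forall x y, (x, y) \in R k ->
        #|[set z | ((x, z) \in R i) && ((z, y) \in R j)]| = c].

(* The scalars C play the role of the complex numbers: both algC and R[i], for
   R a real closed field, are instances of numClosedFieldType. *)
Variable C : numClosedFieldType.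

Definition adjacency_mx (i : 'I_d.+1) : 'M[C]_#|X| :=
  \matrix_(a, b) ((enum_val a, enum_val b) \in R i)%:R.

Definition bose_mesner : {vspace 'M[C]_#|X|} :=
  <<[seq adjacency_mx i | i : 'I_d.+1]>>%VS.

Definition bm_idempotent (M : 'M[C]_#|X|) : Prop :=
  M \in bose_mesner /\ M *m M = M.

Definition primitive_idempotent (M : 'M[C]_#|X|) : Prop :=
  [/\ bm_idempotent M, M != 0
    & forall A B, bm_idempotent A -> bm_idempotent B ->
        A *m B = 0 -> B *m A = 0 -> M = A + B -> A = 0 \/ B = 0].

Definition pseudocyclic : Prop :=
  exists E : 'I_d.+1 -> 'M[C]_#|X|,
    [/\ injective E,
        forall M, primitive_idempotent M <-> exists i, M = E i,
        E ord0 = #|X|%:R^-1 *: const_mx 1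
      & exists t : nat, forall i, i != ord0 -> \rank (E i) = t].

End AssociationScheme.

(* The order of the class of a in the unit group of Z/n, for n > 1 and a
   coprime to n (if a is not coprime to n, the value is the junk #[1] = 1). *)
Definition mult_ord (n a : nat) : nat :=
  #[insubd (1%g : {unit 'Z_n}) (a%:R : 'Z_n)]%g.

Section Cyclotomy.

Variables (F : finFieldType) (g : {unit F}).

Definition cyclotomic_class (N i : nat) : {set F} :=
  [set FinRing.uval u | u in (g ^+ i *: <[g ^+ N]>)%g].

Variables p1 m : nat.

Definition fused_class (k : nat) : {set F} :=
  \bigcup_(i < (p1 ^ m.-1)%N)
     cyclotomic_class (p1 ^ m)%N (i + k * p1 ^ m.-1)%N.

Definition fused_rel (k : 'I_p1.+1) : {set F * F} :=
  if nat_of_ord k is k'.+1 then [set xy | xy.1 - xy.2 \in fused_class k']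
  else [set (x, x) | x : F].

End Cyclotomy.

(* Main.v *)
Require Import Defs.
From HB Require Import structures.
From mathcomp Require Import all_boot all_order all_algebra all_fingroup all_solvable.
From mathcomp Require Import finfield.

(** Let psi be the canonical additive character of F, eta_j the sum of psi over
    C_j (a Gauss period), and n = p1^(m-1).  Since psi is invariant under the
    Frobenius map, eta_(pj) = eta_j.  The residues congruent to 1 mod p1 have
    odd order mod N, hence lie in the index 2 subgroup generated by p, so that
    eta_(lj) = eta_j for all l = 1 mod p1; this gives eta_(a+n) = eta_a unless
    n divides a.  Therefore the sum of n consecutive periods starting at a
    depends only on the ceiling of a/n: the Fourier transforms of the classes
    D_k are constant on the classes {gamma^a | ceil(a/n) = b mod p1}.  There
    are as many of these dual classes (together with 0) as there are D_k
    (together with 0), so the span of the adjacency matrices equals the span of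
    the orthogonal idempotents attached to the dual classes.  The nonzero dual
    classes are permuted transitively by multiplication by powers of gamma^n,
    whence the equality of the ranks. *)

Set Implicit Arguments.
Unset Strict Implicit.
Unset Printing Implicit Defensive.

Import GRing.Theory.

(** * A nontrivial additive character invariant under Frobenius *)

Section AdditiveCharacter.

Import Order.TTheory GRing.Theory Num.Theory.
Local Open Scope ring_scope.

(** Any root of 1 + X + ... + X^(p-1) works: at 1 this polynomial takes the value p, nonzero in
    characteristic 0. *)
Lemma prime_unity_root_neq1 (C : numClosedFieldType) (p : nat) :
  prime p -> exists2 z : C, z ^+ p = 1 & z != 1.
Proof.
move=> p_pr; have p_gt1 := prime_gt1 p_pr.
pose P : {poly C} := \sum_(i < p) 'X^i.
have sP : size P != 1%N.
  rewrite /P (_ : \sum_(i < p) 'X^i = \poly_(i < p) (1 : C)); last first.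
    by rewrite poly_def; apply: eq_bigr => i _; rewrite scale1r.
  by rewrite size_poly_eq ?oner_eq0 // neq_ltn p_gt1 orbT.
have /closed_rootP [z /rootP Pz] := sP.
have {}Pz : \sum_(i < p) z ^+ i = 0.
  by rewrite -[RHS]Pz horner_sum; apply: eq_bigr => i _; rewrite hornerXn.
exists z; first by apply/eqP; rewrite -subr_eq0 subrX1 Pz mulr0.
apply/eqP=> z1; move/eqP: Pz; rewrite z1.
under eq_bigr do rewrite expr1n.
by rewrite sumr_const card_ord pnatr_eq0; case: (p) p_gt1.
Qed.

Variables (F : finFieldType) (p f : nat).
Hypotheses (p_pr : prime p) (card_F : #|F| = (p ^ f)%N).

Let p_char : p \in [pchar F] := card_finPcharP card_F p_pr.

(** X^p - X already has the p residues as roots, so its degree leaves no room for another one. *)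
Lemma frobenius_fixed_natr (y : F) : y ^+ p = y -> exists k : nat, y = k%:R.
Proof.
move=> yp; pose P : {poly F} := 'X^p - 'X.
have sP : size P = p.+1.
  by rewrite size_polyDl ?size_polyXn // size_polyN size_polyX ltnS prime_gt1.
have P_neq0 : P != 0 by rewrite -size_poly_eq0 sP.
pose rs := [seq (i : nat)%:R : F | i <- iota 0 p].
have rs_uniq : uniq rs.
  rewrite map_inj_in_uniq ?iota_uniq // => i j.
  rewrite !mem_iota /= => lt_ip lt_jp /eqP.
  wlog le_ij : i j lt_ip lt_jp / (i <= j)%N.
    move=> W; case/orP: (leq_total i j) => le; first exact: W.
    by rewrite eq_sym => /(W _ _ lt_jp lt_ip le) ->.
  rewrite eq_sym -subr_eq0 -natrB // -(dvdn_pcharf p_char) => dv.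
  apply/eqP; rewrite eqn_leq le_ij -subn_eq0 /=; apply: contraLR dv.
  by rewrite -lt0n => lt; rewrite gtnNdvd // (leq_ltn_trans (leq_subr _ _)).
have [|y_notin] := boolP (y \in rs); first by case/mapP=> k _ ->; exists k.
have := @max_poly_roots _ P (y :: rs) P_neq0.
rewrite /= y_notin rs_uniq size_map size_iota sP ltnn andbT.
suff -> : root P y && all (root P) rs by move=> /(_ isT isT).
have rootP_P x : x ^+ p = x -> root P x.
  by move=> xp; rewrite rootE !hornerE xp subrr.
rewrite rootP_P //; apply/allP=> _ /mapP[k _ ->]; apply: rootP_P.
by rewrite -pFrobenius_autE pFrobenius_aut_nat.
Qed.

(** The absolute trace, kept with values in [F]; [trX] and [frobenius_fixed_natr] place them in the
    prime field. *)
Let tr (x : F) : F := \sum_(i < f) x ^+ (p ^ i).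

Let frobXD i (x y : F) : (x + y) ^+ (p ^ i) = x ^+ (p ^ i) + y ^+ (p ^ i).
Proof.
elim: i => [|i IH]; first by rewrite !expr1.
by rewrite expnSr !exprM IH -!(pFrobenius_autE p_char) rmorphD.
Qed.

Let trD x y : tr (x + y) = tr x + tr y.
Proof. by rewrite /tr -big_split; apply: eq_bigr => i _; rewrite frobXD. Qed.

(** Frobenius shifts the terms cyclically, because x^(p^f) = x. *)
Let tr_frob x : tr (x ^+ p) = tr x.
Proof.
rewrite /tr; under eq_bigr do rewrite -exprM -expnS.
case: f card_F => [|k] card_Fk; first by rewrite !big_ord0.
rewrite big_ord_recr /= -card_Fk expf_card [RHS]big_ord_recl expr1 addrC.
by congr (_ + _); apply: eq_bigr.
Qed.

Let trX x : tr x ^+ p = tr x.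
Proof.
rewrite -[RHS]tr_frob -(pFrobenius_autE p_char) /tr rmorph_sum /=.
by apply: eq_bigr => i _; rewrite (pFrobenius_autE p_char) exprAC.
Qed.

(** The trace is a polynomial of degree at most p^(f-1) with X-coefficient 1; it cannot vanish at
    all p^f points. *)
Let tr_neq0 : exists x, tr x != 0.
Proof.
have f_gt0 : (0 < f)%N.
  by case: f card_F => // card1; have := finNzRing_gt1 F; rewrite card1.
pose P : {poly F} := \sum_(i < f) 'X^(p ^ i).
have P_neq0 : P != 0.
  apply/eqP => /(congr1 (fun q : {poly F} => q`_1)); rewrite coef0 coef_sum.
  rewrite (bigD1 (Ordinal f_gt0)) //= coefXn eqxx big1 ?addr0.
    by move/eqP; rewrite oner_eq0.
  move=> [[|i] lt_i] //= _; rewrite coefXn expnS.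
  by rewrite eq_sym muln_eq1 (gtn_eqF (prime_gt1 p_pr)).
have sP : (size P <= (p ^ f.-1).+1)%N.
  apply: leq_trans (size_sum _ _ _) _; apply/bigmax_leqP => i _.
  by rewrite size_polyXn ltnS leq_exp2l ?prime_gt1 // -ltnS prednK.
case: (pickP (fun x => tr x != 0)) => [x nz|tr0]; first by exists x.
have := @max_poly_roots _ P (enum F) P_neq0; rewrite enum_uniq -cardE card_F.
have -> : all (root P) (enum F).
  apply/allP=> x _; rewrite rootE horner_sum; move/negbFE: (tr0 x).
  by rewrite /tr; under [X in _ -> X == _]eq_bigr do rewrite hornerXn.
move=> /(_ isT isT) /leq_trans /(_ sP).
by rewrite ltnS leqNgt ltn_exp2l ?prime_gt1 // prednK ?leqnn.
Qed.

Lemma frobenius_invariant_character (C : numClosedFieldType) :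
  exists psi : F -> C,
    [/\ psi 0 = 1, {morph psi : x y / x + y >-> x * y},
        exists x, psi x != 1 & forall x, psi (x ^+ p) = psi x].
Proof.
have [z zp z1] := prime_unity_root_neq1 C p_pr.
have trE x : {k : nat | tr x == k%:R}.
  by apply: sigW; case: (frobenius_fixed_natr (trX x)) => k ->; exists k.
have zE k l : (k%:R : F) = l%:R -> z ^+ k = z ^+ l.
  wlog le_kl : k l / (k <= l)%N.
    by move=> W; case/orP: (leq_total k l) => le E; [|symmetry]; apply: W.
  move=> /esym/eqP; rewrite -subr_eq0 -natrB // -(dvdn_pcharf p_char).
  by case/dvdnP=> j E; rewrite -(subnKC le_kl) exprD E mulnC exprM zp expr1n mulr1.
(* The choice of representative of the trace is harmless by [zE], since z^p = 1. *)
pose psi x := z ^+ sval (trE x).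
have psiE x k : tr x = k%:R -> psi x = z ^+ k.
  by rewrite /psi; case: (trE x) => l /= /eqP -> /zE.
have svE x : tr x = (sval (trE x))%:R by case: (trE x) => l /= /eqP.
exists psi; split.
- apply: (psiE 0 0%N); rewrite /tr big1 // => i _.
  by rewrite expr0n expn_eq0 (gtn_eqF (prime_gt0 p_pr)).
- by move=> x y; rewrite -exprD; apply: psiE; rewrite trD natrD -!svE.
(* As [tr x] is fixed by Frobenius, it factors out of the trace, so this witness has trace 1. *)
- have [x nz] := tr_neq0; exists (x / tr x).
  suff -> : psi (x / tr x) = z ^+ 1 by rewrite expr1.
  apply: psiE; rewrite /tr; under eq_bigr => i _.
    have -> : (x / tr x) ^+ (p ^ i) = x ^+ (p ^ i) / tr x.
      rewrite exprMn; congr (_ * _); elim: (i : nat) => [|j IH] //.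
      by rewrite expnSr exprM IH exprVn trX.
    over.
  by rewrite -mulr_suml divff.
- by move=> x; rewrite (@psiE _ (sval (trE x))) // tr_frob -svE.
Qed.

End AdditiveCharacter.

Lemma mxrank_mxsub (K : fieldType) (m n m' n' : nat) (M : 'M[K]_(m, n))
    (g : 'I_m' -> 'I_m) (h : 'I_n' -> 'I_n) :
  \rank (mxsub g h M) <= \rank M.
Proof.
rewrite -[M in mxsub _ _ M]mulmx1 mxsub_mul rowsubE -mulmxA.
exact: leq_trans (mxrankM_maxr _ _) (mxrankM_maxl _ _).
Qed.

(** * Translation schemes on [F] and their primitive idempotents *)

Section CayleyScheme.

Import Order.TTheory GRing.Theory Num.Theory.
Local Open Scope ring_scope.

Variables (C : numClosedFieldType) (F : finFieldType) (psi : F -> C).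
Hypotheses (psi0 : psi 0 = 1) (psiD : {morph psi : x y / x + y >-> x * y}).
Hypothesis psi_neq1 : exists x, psi x != 1.

Let q : C := #|F|%:R.

Let q_neq0 : q != 0.
Proof. by rewrite pnatr_eq0 -lt0n (leq_trans _ (finNzRing_gt1 F)). Qed.

(** For a nonzero, translating x by y / a multiplies the sum by [psi y], which can be chosen
    different from 1. *)
Lemma sum_additive_character (a : F) :
  \sum_x psi (a * x) = (a == 0)%:R * #|F|%:R.
Proof.
have [->|a_neq0] := eqVneq a 0.
  under eq_bigr do rewrite mul0r psi0.
  by rewrite sumr_const mul1r.
rewrite mul0r; have [y psi_y] := psi_neq1.
have /eqP : \sum_x psi (a * x) = psi y * \sum_x psi (a * x).
  rewrite mulr_sumr (reindex_inj (addrI (y / a))) /=; apply: eq_bigr => x _.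
  by rewrite mulrDr mulrCA divff // mulr1 psiD.
rewrite -subr_eq0 -{1}[X in X - _]mul1r -mulrBl mulf_eq0 subr_eq0 eq_sym.
by rewrite (negPf psi_y) => /eqP.
Qed.

(** [D] indexes the relations by the difference x - y, [S] indexes the dual classes of characters.
    Sharing the index type ['I_d.+1] encodes that there are equally many of each. *)
Variables (d : nat) (D S : F -> 'I_d.+1) (R : 'I_d.+1 -> {set F * F}).
Hypothesis RE : forall k x y, ((x, y) \in R k) = (D (x - y) == k).
Hypotheses (D0 : forall x, (D x == ord0) = (x == 0))
           (S0 : forall x, (S x == ord0) = (x == 0)).
Hypotheses (D_surj : forall k, exists x, D x == k)
           (S_surj : forall k, exists x, S x == k).
Hypothesis DN : forall x, D (- x) = D x.
Hypothesis D_hat : forall k s t, S s = S t ->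
  \sum_(x | D x == k) psi (s * x) = \sum_(x | D x == k) psi (t * x).

(** The projection onto the span of the characters x |-> psi (s * x) with s in the dual class b. *)
Let E (b : 'I_d.+1) : 'M[C]_#|F| :=
  \matrix_(i, j)
    (q^-1 * \sum_(s | S s == b) psi (s * (enum_val i - enum_val j))).

Local Notation A := (adjacency_mx R C).

Let psi_split s t x y z :
  psi (s * (x - z)) * psi (t * (z - y)) = psi (s * x - t * y) * psi ((t - s) * z).
Proof.
rewrite -!psiD; congr (psi _).
rewrite !mulrBr mulrBl addrACA [RHS]addrAC -!addrA; congr (_ + _).
Qed.

(** Orthogonality of characters kills every term with t != s, and the surviving factor |F| cancels
    one of the two [q^-1]. *)
Let E_mul b c : E b *m E c = (b == c)%:R *: E b.
Proof.
apply/matrixP => i j; rewrite !mxE.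
set x := enum_val i; set y := enum_val j.
transitivity (q^-1 * (q^-1 * \sum_(s | S s == b) \sum_(t | S t == c)
     psi (s * x - t * y) * \sum_z psi ((t - s) * z))).
  under eq_bigr do rewrite !mxE mulrACA -/x -/y -[_ * _ * _]mulrA.
  rewrite -(@big_enum_val _ _ _ _ F (fun z => q^-1 * (q^-1 *
     ((\sum_(s | S s == b) psi (s * (x - z))) *
      (\sum_(t | S t == c) psi (t * (z - y))))))) /=.
  rewrite -!mulr_sumr; congr (_ * (_ * _)).
  under [LHS]eq_bigr do rewrite mulr_suml.
  rewrite exchange_big /=; apply: eq_bigr => s _.
  under [LHS]eq_bigr do rewrite mulr_sumr.
  rewrite exchange_big /=; apply: eq_bigr => t _.
  by rewrite mulr_sumr; apply: eq_bigr => z _; rewrite psi_split.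
rewrite [RHS]mulrCA; congr (_ * _); rewrite !mulr_sumr; apply: eq_bigr => s /eqP Ss.
under eq_bigr do rewrite sum_additive_character subr_eq0.
rewrite big_mkcond (bigD1 s) //= eqxx mul1r Ss big1 => [|t /negPf ->]; last first.
  by rewrite mul0r mulr0 if_same.
rewrite addr0; case: eqP => _; last by rewrite mulr0 mul0r.
by rewrite mul1r mulrC mulfK // mulrBr.
Qed.

Let E_diag b i : E b i i != 0.
Proof.
rewrite mxE subrr; under eq_bigr do rewrite mulr0 psi0.
rewrite sumr_const mulf_eq0 invr_eq0 (negPf q_neq0) /= pnatr_eq0 -lt0n.
by have [x Sx] := S_surj b; apply/card_gt0P; exists x.
Qed.

Let i0 : 'I_#|F| := enum_rank 0.

Let E_neq0 b : E b != 0.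
Proof. by apply: contraNneq (E_diag b i0) => ->; rewrite mxE. Qed.

Let E_inj : injective E.
Proof.
move=> b c Ebc; have := E_mul b c; rewrite -Ebc E_mul eqxx scale1r.
by case: eqP => // _; rewrite scale0r => Eb0; case/eqP: (E_neq0 b).
Qed.

Let Et : d.+1.-tuple 'M[C]_#|F| := [tuple E b | b < d.+1].
Let At : d.+1.-tuple 'M[C]_#|F| := [tuple A b | b < d.+1].

Let AtE (b : 'I_d.+1) : At`_b = A b.
Proof. by rewrite -tnth_nth tnth_mktuple. Qed.

Let spanP (X : 'I_d.+1 -> 'M[C]_#|F|) M :
  reflect (exists c : 'I_d.+1 -> C, M = \sum_b c b *: X b)
    (M \in <<[tuple X b | b < d.+1]>>%VS).
Proof.
apply: (iffP idP) => [/coord_span E1|[c ->]].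
  exists (fun b => coord [tuple X b | b < d.+1] b M); rewrite {1}E1.
  by apply: eq_bigr => b _; rewrite -tnth_nth tnth_mktuple.
apply: memv_suml => b _; apply/memvZ/memv_span.
by apply/tnthP; exists b; rewrite tnth_mktuple.
Qed.

Let A_in_E k : A k \in <<Et>>%VS.
Proof.
apply/spanP; pose r b := xchoose (S_surj b).
have Sr b : S (r b) = b by apply/eqP/(xchooseP (S_surj b)).
exists (fun b => \sum_(x | D x == k) psi (r b * x)).
apply/matrixP => i j; rewrite summxE mxE RE.
set x := enum_val i; set y := enum_val j.
(* Fourier inversion: the inner sum detects z = y - x, and [DN] turns this into x - y. Grouping s by
   dual class then makes the transform of the class k the coefficient of [E b]. *)
transitivity (q^-1 * \sum_(z | D z == k) \sum_s psi ((z + (x - y)) * s)).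
  under eq_bigr => z _ do rewrite sum_additive_character -/q addr_eq0 opprB.
  rewrite -mulr_suml mulrC mulfK // big_mkcond (bigD1 (y - x)) //= eqxx big1.
    by rewrite addr0 -DN opprB; case: eqP.
  by move=> z /negPf ->; rewrite if_same.
rewrite exchange_big /= mulr_sumr (partition_big S predT) //=.
apply: eq_bigr => b _; rewrite !mxE mulrCA !mulr_sumr; apply: eq_bigr => s /eqP Ss.
congr (_ * _); rewrite (@D_hat k (r b) s) ?Sr // mulr_suml.
by apply: eq_bigr => z _; rewrite -psiD -mulrDr mulrC.
Qed.

Let A_sum (c : 'I_d.+1 -> C) i j :
  (\sum_b c b *: A b) i j = c (D (enum_val i - enum_val j)).
Proof.
rewrite summxE (bigD1 (D (enum_val i - enum_val j))) //= big1 => [|b nb].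
  by rewrite !mxE RE eqxx mulr1 addr0.
by rewrite !mxE RE eq_sym (negPf nb) mulr0.
Qed.

Let At_free : free At.
Proof.
apply/freeP => c c0 k; have [x /eqP Dx] := D_surj k.
have {}c0 : \sum_b c b *: A b = 0.
  by rewrite -[RHS]c0; apply: eq_bigr => b _; rewrite AtE.
have := A_sum c (enum_rank x) (enum_rank 0).
by rewrite c0 mxE !enum_rankK subr0 Dx.
Qed.

(** One inclusion is [A_in_E]; equality follows by dimension, since the d + 1 adjacency matrices are
    free and the other span has only d + 1 generators. *)
Let bmE : bose_mesner R C = <<Et>>%VS.
Proof.
have -> : bose_mesner R C = <<At>>%VS by [].
apply/eqP; rewrite eqEdim; apply/andP; split.
  by apply/span_subvP => _ /tnthP[b ->]; rewrite tnth_mktuple A_in_E.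
move: At_free; rewrite /free => /eqP ->; rewrite size_tuple.
by apply: leq_trans (dim_span _) _; rewrite size_tuple.
Qed.

Let E_sum_mul (c c' : 'I_d.+1 -> C) :
  (\sum_b c b *: E b) *m (\sum_b c' b *: E b) = \sum_b (c b * c' b) *: E b.
Proof.
rewrite mulmx_suml; apply: eq_bigr => b _; rewrite mulmx_sumr (bigD1 b) //=.
rewrite big1 => [|b' nb]; rewrite -scalemxAl -scalemxAr E_mul.
  by rewrite eqxx scale1r addr0 scalerA.
by rewrite eq_sym (negPf nb) scale0r !scaler0.
Qed.

Let E_sum_inj (c c' : 'I_d.+1 -> C) :
  \sum_b c b *: E b = \sum_b c' b *: E b -> c =1 c'.
Proof.
move=> Ecc b; have /(congr1 (mulmx (E b))) := Ecc.
have mulE (e : 'I_d.+1 -> C) : E b *m (\sum_b e b *: E b) = e b *: E b.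
  rewrite mulmx_sumr (bigD1 b) //= big1 => [|b' nb]; rewrite -scalemxAr E_mul.
    by rewrite eqxx scale1r addr0.
  by rewrite eq_sym (negPf nb) scale0r scaler0.
rewrite !mulE => /eqP; rewrite -subr_eq0 -scalerBl scaler_eq0 (negPf (E_neq0 b)).
by rewrite orbF subr_eq0 => /eqP.
Qed.

(** The intersection numbers come from closure: the span of the adjacency matrices is that of the
    orthogonal idempotents, hence stable under products, and its elements have entries depending
    only on [D (x - y)]. *)
Lemma cayley_association_scheme : association_scheme R.
Proof.
have R_inj : injective R.
  move=> k l Rkl; have [x Dx] := D_surj k.
  have: (x, 0) \in R k by rewrite RE subr0.
  by rewrite Rkl RE subr0 (eqP Dx) => /eqP.
split.
- split=> //; apply/and3P; split.
  + apply/eqP/setP => -[x y]; rewrite inE; apply/bigcupP.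
    by exists (R (D (x - y))); rewrite ?imset_f // RE.
  + apply/trivIsetP => _ _ /imsetP[k _ ->] /imsetP[l _ ->] neq_kl.
    rewrite -setI_eq0; apply/eqP/setP => -[x y]; rewrite !inE !RE.
    by apply: contraNF neq_kl => /andP[/eqP <- /eqP <-].
  + apply/imsetP => -[k _ /setP Rk]; have [x Dx] := D_surj k.
    by have := Rk (x, 0); rewrite RE subr0 Dx inE.
- apply/setP => -[x y]; rewrite RE D0 subr_eq0; apply/eqP/imsetP.
    by move=> ->; exists y.
  by case=> z _ [-> ->].
- by move=> k x y; rewrite !RE -DN opprB.
move=> i j k.
have /spanP[c Ec] : A i *m A j \in <<At>>%VS.
  have -> : <<At>>%VS = <<Et>>%VS by rewrite -bmE.
  have /spanP[ci ->] := A_in_E i; have /spanP[cj ->] := A_in_E j.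
  by apply/spanP; rewrite E_sum_mul; exists (fun b => ci b * cj b).
have cardE x y : #|[set z | ((x, z) \in R i) && ((z, y) \in R j)]|%:R = c (D (x - y)).
  have := A_sum c (enum_rank x) (enum_rank y); rewrite -Ec !enum_rankK => <-.
  rewrite mxE -sum1_card natr_sum big_mkcond /=.
  rewrite (eq_bigl (mem F)) // (big_enum_val (A := F)) /=.
  by apply: eq_bigr => l _; rewrite !mxE !enum_rankK inE -natrM mulnb; case: (_ && _).
have [x0 /eqP Dx] := D_surj k.
exists #|[set z | ((x0, z) \in R i) && ((z, 0) \in R j)]| => x y.
rewrite RE => /eqP Dxy; apply/eqP.
by rewrite -(eqr_nat C) !cardE subr0 Dxy Dx.
Qed.

(** The coefficients on the [E b] multiply pointwise, so those of an idempotent are 0 or 1. *)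
Let bm_idemP M : bm_idempotent R M ->
  exists B : {set 'I_d.+1}, M = \sum_b (b \in B)%:R *: E b.
Proof.
case; rewrite bmE => /spanP[c Mc] MM.
have c_idem b : c b * c b = c b.
  by move: b; apply: E_sum_inj; rewrite -E_sum_mul -Mc.
exists [set b | c b != 0]; rewrite Mc; apply: eq_bigr => b _; rewrite inE.
have [-> //|cb] := eqVneq (c b) 0.
by have /(mulfI cb) -> : c b * c b = c b * 1 by rewrite mulr1 c_idem.
Qed.

Let bm_idem (B : {set 'I_d.+1}) : bm_idempotent R (\sum_b (b \in B)%:R *: E b).
Proof.
split; first by rewrite bmE; apply/spanP; exists (fun b => (b \in B)%:R).
by rewrite E_sum_mul; apply: eq_bigr => b _; rewrite -natrM mulnb andbb.
Qed.

Let E1 b : E b = \sum_b' (b' \in [set b])%:R *: E b'.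
Proof.
rewrite (bigD1 b) //= big1 => [|b' nb]; rewrite inE ?eqxx ?scale1r ?addr0 //.
by rewrite (negPf nb) scale0r.
Qed.

Let E_set0 : \sum_b (b \in (set0 : {set 'I_d.+1}))%:R *: E b = 0.
Proof. by rewrite big1 // => b _; rewrite inE scale0r. Qed.

Let E_primitive M : primitive_idempotent R M <-> exists b, M = E b.
Proof.
split=> [[idM M_neq0 primM]|[b ->]].
  have [B MB] := bm_idemP idM.
  have [B0|[b bB]] := set_0Vmem B.
    by case/eqP: M_neq0; rewrite MB B0 E_set0.
  exists b.
  (* Splitting off [E b] writes M as a sum of two orthogonal idempotents; primitivity then leaves B
     = {b}. *)
  case: (primM (E b) (\sum_c (c \in B :\ b)%:R *: E c)).
  - by rewrite E1; apply: bm_idem.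
  - exact: bm_idem.
  - rewrite E1 E_sum_mul big1 // => c _; rewrite -natrM mulnb !inE.
    by case: eqP; rewrite ?andbF ?scale0r.
  - rewrite E1 E_sum_mul big1 // => c _; rewrite -natrM mulnb !inE.
    by case: eqP; rewrite ?andbF ?scale0r.
  - rewrite {1}E1 MB -big_split /=; apply: eq_bigr => c _.
    rewrite !inE -scalerDl; congr (_ *: _).
    by case: eqP => [->|_]; rewrite ?bB ?addr0 ?add0r.
  - by move/eqP; rewrite (negPf (E_neq0 b)).
  - move=> B'0; rewrite MB [RHS]E1; apply: eq_bigr => c _; rewrite inE.
    have /E_sum_inj/(_ c) : \sum_c (c \in B :\ b)%:R *: E c
        = \sum_c (c \in (set0 : {set 'I_d.+1}))%:R *: E c by rewrite B'0 E_set0.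
    rewrite !inE; case: eqP => [->|_]; first by rewrite bB.
    by move=> /= ->.
split; [by rewrite E1; apply: bm_idem | exact: E_neq0 |].
move=> _ _ /bm_idemP[X ->] /bm_idemP[Y ->] _ _.
rewrite {1}E1 -big_split /=; under [X in _ = X -> _]eq_bigr do rewrite -scalerDl.
move=> /E_sum_inj EXY.
(* The indicators of Z and Z' add up to that of {b}, so Z' is empty as soon as b lies in Z. *)
have sX (Z Z' : {set 'I_d.+1}) :
  (forall c, (c \in [set b])%:R = (c \in Z)%:R + (c \in Z')%:R :> C) -> b \in Z ->
  \sum_c (c \in Z')%:R *: E c = 0.
  move=> EZ bZ; rewrite big1 // => c _; have := EZ c; rewrite !inE -natrD => /eqP.
  rewrite eqr_nat; case: (c =P b) => [->|_]; rewrite ?bZ.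
    by case: (b \in Z') => //; rewrite scale0r.
  by case: (c \in Z); case: (c \in Z') => //; rewrite scale0r.
have := EXY b; rewrite inE eqxx -natrD => /eqP; rewrite eqr_nat.
case bX: (b \in X); first by right; apply: (sX X).
case bY: (b \in Y) => //; left; apply: (sX Y) => // c.
by rewrite EXY addrC.
Qed.

Let E_ord0 : E ord0 = #|F|%:R^-1 *: const_mx 1.
Proof.
apply/matrixP => i j; rewrite !mxE; congr (_ * _).
under eq_bigl do rewrite S0.
by rewrite big_pred1_eq mul0r psi0.
Qed.

Hypothesis S_homogeneous : forall b c, b != ord0 -> c != ord0 ->
  exists2 u : F, u != 0 & forall s, (S (u * s) == b) = (S s == c).

(** Multiplication by u permutes [F] and carries one dual class to the other, so [E b] is [E c] with
    rows and columns permuted. *)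
Let rankE_le b c : b != ord0 -> c != ord0 -> (\rank (E b) <= \rank (E c))%N.
Proof.
move=> nb nc; have [u u_neq0 Su] := S_homogeneous nb nc.
pose g (i : 'I_#|F|) : 'I_#|F| := enum_rank (u * enum_val i).
suff -> : E b = mxsub g g (E c) by apply: mxrank_mxsub.
apply/matrixP => i j; rewrite !mxE !enum_rankK; congr (_ * _).
rewrite (reindex_inj (mulfI u_neq0)) /=; apply: eq_big => [s|s _]; first exact: Su.
by rewrite -mulrBr mulrCA mulrA.
Qed.

Lemma cayley_pseudocyclic : pseudocyclic R C.
Proof.
exists E; split=> //.
have [b nb|allb] := pickP (fun b : 'I_d.+1 => b != ord0).
  by exists (\rank (E b)) => c nc; apply/eqP; rewrite eqn_leq !rankE_le.
by exists 0%N => c; rewrite allb.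
Qed.

End CayleyScheme.

(** * Arithmetic modulo a prime power *)

(** Induction on k: x^p - 1 is x - 1 times a sum of p powers of x, each congruent to 1 mod p when x
    is, so each step gains a factor p. *)
Lemma expn_pfactor_congr1 (p l k : nat) :
  l = 1 %[mod p] -> l ^ (p ^ k) = 1 %[mod p ^ k.+1].
Proof.
case: l => [|l] l1.
  have /eqP -> : p == 1 by rewrite -dvdn1 /dvdn -l1 mod0n.
  by rewrite !exp1n !modn1.
have pred_dvd x d : 0 < x -> (d %| x.-1) = (x == 1 %[mod d]).
  by move=> x_gt0; rewrite eqn_mod_dvd // subn1.
have l1X i : l.+1 ^ i = 1 %[mod p] by rewrite -modnXm l1 modnXm exp1n.
apply/eqP; rewrite -pred_dvd ?expn_gt0 //.
elim: k => [|k IHk]; first by rewrite pred_dvd // expn0 !expn1 l1.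
rewrite [p ^ k.+2]expnSr [p ^ k.+1 in X in _ %| X]expnSr expnM predn_exp dvdn_mul //.
rewrite /dvdn -modn_summ.
under eq_bigr do rewrite -expnM l1X.
by rewrite modn_summ sum_nat_const card_ord muln1 modnn.
Qed.

Lemma eqn_modMl_coprime (d k x y : nat) :
  coprime k d -> (k * x == k * y %[mod d]) = (x == y %[mod d]).
Proof.
move=> co_kd; wlog le_yx : x y / y <= x.
  move=> W; case/orP: (leq_total x y) => le; last exact: W.
  by rewrite eq_sym W // eq_sym.
by rewrite !eqn_mod_dvd ?leq_mul2l ?le_yx ?orbT // -mulnBr Gauss_dvdr // coprime_sym.
Qed.

Lemma Zp_natr_eq (N a b : nat) :
  1 < N -> ((a%:R : 'Z_N) == b%:R)%R = (a == b %[mod N]).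
Proof.
by move=> N_gt1; rewrite -(inj_eq val_inj) /= !val_Zp_nat.
Qed.

Lemma val_insubd_Zp (N a : nat) : 1 < N -> coprime a N ->
  val (insubd (1%g : {unit 'Z_N}) (a%:R : 'Z_N)%R) = (a%:R)%R.
Proof.
by move=> N_gt1 co_aN; rewrite insubdK // -topredE /= unitZpE // coprime_sym.
Qed.

Lemma expn_mult_ord (N a : nat) :
  1 < N -> coprime a N -> a ^ mult_ord N a = 1 %[mod N].
Proof.
move=> N_gt1 co_aN; apply/eqP; rewrite -Zp_natr_eq // natrX.
by rewrite -(val_insubd_Zp N_gt1 co_aN) -FinRing.val_unitX expg_order.
Qed.

(* An element of odd order lies in every subgroup of index 2, and the residues
   that are 1 mod p1 have order a power of p1. *)
Lemma congr1_power_of (p1 m p l : nat) :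
  prime p1 -> 2 < p1 -> 0 < m -> coprime p (p1 ^ m) ->
  mult_ord (p1 ^ m) p = totient (p1 ^ m) %/ 2 ->
  l = 1 %[mod p1] -> exists t, l = p ^ t %[mod p1 ^ m].
Proof.
move=> p1_pr p1_gt2 m_gt0 co_p; set N := p1 ^ m => ord_p l1.
have p1_odd : odd p1 by case/even_prime: p1_pr p1_gt2 => [->|].
have N_gt1 : 1 < N by rewrite -(expn0 p1) ltn_exp2l ?prime_gt1.
have co_l : coprime l N by rewrite coprimeXr // -coprime_modl l1 coprime_modl coprime1n.
have valu := val_insubd_Zp N_gt1 co_p; have valv := val_insubd_Zp N_gt1 co_l.
move: ord_p valu valv; rewrite /mult_ord.
set u := insubd _ _; set v := insubd _ (l%:R)%R => ord_p valu valv.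
pose G := [set: {unit 'Z_N}]%G.
have cardG : #|G| = totient N by rewrite -card_units_Zp // ltnW.
have tot2 : totient N = 2 * (totient N %/ 2).
  rewrite mulnC divnK // totient_pfactor // dvdn_mulr // dvdn2.
  by case: (p1) p1_odd.
have tot_gt0 : 0 < totient N by rewrite totient_gt0 ltnW.
have indexH : #|G : <[u]>|%g = 2.
  have := Lagrange (subsetT <[u]>%g); rewrite cardG -orderE ord_p [RHS]tot2 mulnC.
  by move/eqP; rewrite eqn_pmul2r; [move/eqP | case: (_ %/ 2) tot2 tot_gt0 => // ->].
have nH : (<[u]> <| G)%g by apply: index2_normal (subsetT _) indexH.
have Nv : v \in 'N(<[u]>)%g by apply: (subsetP (normal_norm nH)); rewrite inE.
(* The quotient has order 2, so the image of every square is trivial. *)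
have v2 : (v ^+ 2)%g \in <[u]>%g.
  apply: coset_idr; first exact: groupX.
  rewrite morphX //; have := card_quotient (normal_norm nH); rewrite indexH => <-.
  by apply: expg_cardG; rewrite mem_quotient ?inE.
have vn : (v ^+ (p1 ^ m.-1))%g = 1%g.
  apply: val_inj; rewrite FinRing.val_unitX valv /= -natrX.
  apply/eqP; rewrite -[1%R]/(1%:R)%R Zp_natr_eq //.
  by have := expn_pfactor_congr1 m.-1 l1; rewrite prednK // => ->.
have : v \in <[u]>%g.
  have odd_n : ((p1 ^ m.-1)./2).*2.+1 = p1 ^ m.-1.
    by rewrite -[RHS]odd_double_half oddX p1_odd orbT.
  (* With n = p1^(m-1) odd and v^n = 1, v equals v^(n+1), a power of v^2. *)
  have -> : v = ((v ^+ 2) ^+ ((p1 ^ m.-1)./2).+1)%g.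
    by rewrite -expgM mul2n doubleS odd_n expgS vn mulg1.
  exact: groupX.
case/cycleP => t /(congr1 val); rewrite FinRing.val_unitX valv valu -natrX => /eqP.
by rewrite Zp_natr_eq // => /eqP; exists t.
Qed.

Lemma shift_as_mul (p1 m a : nat) : prime p1 -> 0 < m ->
  ~~ (p1 ^ m.-1 %| a) ->
  exists2 l, l = 1 %[mod p1] & l * a = a + p1 ^ m.-1 %[mod p1 ^ m].
Proof.
move=> p1_pr m_gt0 ndv.
have a_gt0 : 0 < a by case: a ndv; rewrite ?dvdn0.
have [b co_b Ea] := pfactor_coprime p1_pr a_gt0; set e := logn _ _ in Ea.
have lt_e : e.+1 <= m.-1.
  by rewrite ltnNge; apply: contra ndv => le; rewrite Ea dvdn_mull // dvdn_exp2l.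
have co_bN : coprime b (p1 ^ m) by rewrite coprimeXr // coprime_sym.
have tot_gt0 : 0 < totient (p1 ^ m) by rewrite totient_gt0 expn_gt0 prime_gt0.
(* Since a = b p1^e with e < m - 1, the multiplier 1 + t p1 must satisfy t b = p1^(m-1-e-1) mod N up
   to the factor p1^(e+1); by Euler, b^(phi(N)-1) inverts b. *)
pose t := b ^ (totient (p1 ^ m)).-1 * p1 ^ (m.-1 - e.+1).
exists (t * p1).+1; first by rewrite -addn1 modnMDl.
rewrite mulSn; apply/eqP; rewrite eqn_modDl.
have -> : t * p1 * a = b ^ totient (p1 ^ m) * p1 ^ m.-1.
  have Em : p1 ^ m.-1 = p1 ^ (m.-1 - e.+1) * (p1 * p1 ^ e).
    by rewrite -expnS -expnD subnK.
  have Eb : b ^ totient (p1 ^ m) = b ^ (totient (p1 ^ m)).-1 * b.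
    by rewrite -expnSr prednK.
  rewrite Eb Em [a in LHS]Ea /t -!mulnA; congr (_ * _).
  by rewrite [p1 * (b * _)]mulnCA mulnCA.
by rewrite -modnMml Euler_exp_totient // modnMml mul1n.
Qed.

Lemma modn_mull_split (n p a : nat) : a %% (n * p) = (a %/ n %% p) * n + a %% n.
Proof.
rewrite modn_divl [p * n]mulnC {1}(divn_eq (a %% (n * p)) n).
by rewrite modn_dvdm ?dvdn_mulr.
Qed.

(** * Sums of n consecutive periods *)

Section PeriodSums.

Variables (T : nmodType) (eta : nat -> T) (n : nat).
Hypothesis n_gt0 : 0 < n.
Hypothesis eta_shift : forall a, ~~ (n %| a) -> eta (a + n) = eta a.

Definition window_sum (a : nat) : T := (\sum_(i < n) eta (a + i))%R.

(** A window starting off the multiples of n may slide one step up, hence reaches the next multiple;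
    (a + n - 1) / n is the ceiling of a / n. *)
Lemma window_sum_ceil (a : nat) :
  window_sum a = window_sum (n * ((a + n.-1) %/ n)).
Proof.
(* The two windows differ by eta (b + n) - eta b. *)
have window_sumS b : ~~ (n %| b) -> window_sum b = window_sum b.+1.
  move=> ndv; rewrite /window_sum; case: n n_gt0 (eta_shift ndv) => // k _ Eb.
  rewrite big_ord_recl big_ord_recr /= addn0 addSnnS Eb addrC.
  by congr (_ + _)%R; apply: eq_bigr => i _; rewrite addSnnS.
have down c j : j < n -> window_sum (n * c.+1 - j) = window_sum (n * c.+1).
  elim: j => [|j IHj] lt_jn; first by rewrite subn0.
  have lt_j : j < n * c.+1 by rewrite mulnS ltn_addr // ltnW.
  rewrite window_sumS; last by rewrite dvdn_subr ?dvdn_mulr // gtnNdvd.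
  by rewrite subnSK // IHj // ltnW.
case: a => [|a]; first by rewrite add0n divn_small ?muln0 // prednK.
have -> : (a.+1 + n.-1) %/ n = (a %/ n).+1.
  by rewrite addSnnS prednK // divnDr // divnn n_gt0 addn1.
rewrite -(down _ (n.-1 - a %% n)); last first.
  by rewrite (leq_ltn_trans (leq_subr _ _)) // prednK.
have le_r : a %% n <= n.-1 by rewrite -ltnS prednK // ltn_mod.
congr window_sum; apply/eqP; rewrite -(eqn_add2r (n.-1 - a %% n)) subnK.
  rewrite {1}(divn_eq a n) -addnS -addnA addSn subnKC // prednK //.
  by rewrite mulnS addnC [n * _]mulnC.
by rewrite mulnS (leq_trans (leq_subr _ _)) // (leq_trans (leq_pred _)) ?leq_addr.
Qed.

End PeriodSums.

(** * Gauss periods, fused classes and their dual classes *)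

Section CyclotomicLabels.

Local Open Scope ring_scope.

Variables (C : numClosedFieldType) (F : finFieldType) (p : nat) (psi : F -> C).
Hypotheses (p_char : p \in [pchar F]) (psi_frob : forall x, psi (x ^+ p) = psi x).

Variables (p1 m : nat).
Hypotheses (p1_pr : prime p1) (p1_gt2 : (2 < p1)%N) (m_gt0 : (0 < m)%N).
Local Notation N := (p1 ^ m)%N.
Local Notation n := (p1 ^ m.-1)%N.

Hypotheses (co_p : coprime p N) (ord_p : mult_ord N p = (totient N %/ 2)%N).
Hypothesis N_dvd : (N %| #|F|.-1)%N.

Variable gamma : {unit F}.
Hypothesis gamma_gen : generator [set: {unit F}] gamma.

Let h : F := val gamma.

Let N_E : N = (n * p1)%N.
Proof. by rewrite -expnSr prednK. Qed.

Let n_gt0 : (0 < n)%N.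
Proof. by rewrite expn_gt0 prime_gt0. Qed.

Let p1_gt0 : (0 < p1)%N := prime_gt0 p1_pr.

Let order_gamma : #[gamma]%g = #|F|.-1.
Proof. by rewrite orderE -(eqP gamma_gen) card_finField_unit. Qed.

Let hX a : h ^+ a = val (gamma ^+ a)%g.
Proof. by rewrite FinRing.val_unitX. Qed.

Let hX_neq0 a : h ^+ a != 0.
Proof. by rewrite hX -unitfE (valP (gamma ^+ a)%g). Qed.

Let hX_mod a b : h ^+ a = h ^+ b -> a = b %[mod N].
Proof.
rewrite !hX => /val_inj/eqP; rewrite eq_expg_mod_order order_gamma => /eqP E.
by rewrite -(modn_dvdm a N_dvd) E modn_dvdm.
Qed.

Let log_ex (x : F) : exists a, (x != 0) ==> (x == h ^+ a).
Proof.
have [->|x_neq0] /= := eqVneq x 0; first by exists 0%N.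
have ux : x \is a GRing.unit by rewrite unitfE.
have : FinRing.Unit ux \in <[gamma]>%g by rewrite -(eqP gamma_gen) inE.
by case/cycleP=> a E; exists a; rewrite hX -E.
Qed.

(* Discrete logarithm to the base gamma (arbitrary at 0). *)
Let lg (x : F) : nat := xchoose (log_ex x).

Let lgK x : x != 0 -> x = h ^+ lg x.
Proof. by move=> x_neq0; apply/eqP/(implyP (xchooseP (log_ex x))). Qed.

Let lgX a : lg (h ^+ a) = a %[mod N].
Proof. by apply: hX_mod; rewrite -lgK. Qed.

Let lgM x y : x != 0 -> y != 0 -> lg (x * y) = (lg x + lg y)%N %[mod N].
Proof. by move=> x0 y0; rewrite {1}(lgK x0) {1}(lgK y0) -exprD lgX. Qed.

Let eta (j : nat) : C := \sum_(x | (x != 0) && (lg x == j %[mod N])) psi x.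

Let eta_mod i j : i = j %[mod N] -> eta i = eta j.
Proof. by move=> E; rewrite /eta; apply: eq_bigl => x; rewrite E. Qed.

(** Frobenius permutes [F], multiplies logarithms by p and preserves [psi]. *)
Let eta_frob j : eta (p * j) = eta j.
Proof.
rewrite /eta (reindex_inj (fmorph_inj (pFrobenius_aut p_char))) /=.
apply: eq_big => [x|x _]; rewrite pFrobenius_autE // expf_eq0.
rewrite prime_gt0 ?(pcharf_prime p_char) //=.
have [//|x_neq0] := eqVneq x 0.
by rewrite {1}(lgK x_neq0) -exprM lgX mulnC eqn_modMl_coprime.
Qed.

(** Adding n amounts to multiplying by some l congruent to 1 mod p1, which is a power of p mod N, so
    [eta_frob] can be iterated. *)
Let eta_shift a : ~~ (n %| a)%N -> eta (a + n) = eta a.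
Proof.
move=> ndv; have [l l1 la] := shift_as_mul p1_pr m_gt0 ndv.
have [t lt] := congr1_power_of p1_pr p1_gt2 m_gt0 co_p ord_p l1.
rewrite -(eta_mod la); have -> : eta (l * a) = eta (p ^ t * a).
  by apply: eta_mod; rewrite -modnMml lt modnMml.
by elim: t {lt} => [|t IHt]; rewrite ?mul1n // expnS -mulnA eta_frob.
Qed.

Let block (a : nat) : nat := ((a %/ n) %% p1)%N.

Let block_lt a : (block a < p1)%N.
Proof. by rewrite ltn_mod. Qed.

Let block_mod a b : a = b %[mod N] -> block a = block b.
Proof. by rewrite /block !modn_divl mulnC -N_E => ->. Qed.

(* Label 0 is the zero element. The other labels are the fused classes when
   c = 0, and the dual classes when c = n - 1, where log x is rounded up. *)
Let label (c : nat) (x : F) : 'I_p1.+1 :=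
  if x == 0 then ord0 else inord (block (lg x + c)).+1.

Let label_eqS c x k : (label c x == k.+1 :> nat) = (x != 0) && (block (lg x + c) == k).
Proof.
rewrite /label; case: (x =P 0) => //= _.
by rewrite inordK // ltnS.
Qed.

Let label_eq0 c x : (label c x == ord0) = (x == 0).
Proof.
rewrite /label; case: (x =P 0) => [|_]; first by rewrite eqxx.
by rewrite -(inj_eq val_inj) /= inordK // ltnS.
Qed.

Let label_surj c k : exists x, label c x == k.
Proof.
case: k => [[|k] lt_k]; first by exists 0; rewrite /label eqxx.
(* The term c (N - 1) cancels the offset c modulo N. *)
exists (h ^+ (n * k + c * N.-1)%N).
rewrite -(inj_eq val_inj) /= label_eqS hX_neq0 /=; apply/eqP.
have N_gt0 : (0 < N)%N by rewrite expn_gt0 p1_gt0.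
transitivity (block (n * k)).
  apply: block_mod; rewrite -modnDml lgX modnDml -addnA -mulnSr prednK //.
  by rewrite addnC modnMDl.
by rewrite /block mulKn // modn_small.
Qed.

(** The logarithm of -1 is divisible by N: its double is 0 mod N and N is odd. *)
Let labelN c x : label c (- x) = label c x.
Proof.
rewrite /label oppr_eq0; case: eqP => // /eqP x0; congr (inord _.+1).
apply: block_mod; rewrite -mulN1r -modnDml lgM ?oppr_eq0 ?oner_neq0 //.
rewrite modnDml -addnA -modnDml.
suff /dvdnP[j ->] : (N %| lg (-1)%R)%N by rewrite modnMl.
have N_odd : coprime N 2.
  rewrite coprimeXl // coprimen2; have [E|//] := even_prime p1_pr.
  by move: p1_gt2; rewrite E.
rewrite -(Gauss_dvdl _ N_odd) /dvdn; apply/eqP.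
have -> : (lg (-1)%R * 2)%N = 0%N %[mod N]; last by rewrite mod0n.
by apply: hX_mod; rewrite exprM -lgK ?sqrrN ?expr1n // oppr_eq0 oner_neq0.
Qed.

Let label_homogeneous c a b : a != ord0 -> b != ord0 ->
  exists2 u : F, u != 0 & forall s, (label c (u * s) == a) = (label c s == b).
Proof.
case: a => [[|a] lt_a] // _; case: b => [[|b] lt_b] // _.
(* This factor shifts the blocks by a - b modulo p1; p1 - b avoids truncated subtraction. *)
exists (h ^+ (n * (a + (p1 - b)))%N) => // s.
rewrite -!(inj_eq val_inj) /= !label_eqS mulf_eq0 (negPf (hX_neq0 _)) /=.
case: eqP => //= /eqP s0.
have -> : block (lg (h ^+ (n * (a + (p1 - b)))%N * s) + c)
        = block (n * (a + (p1 - b)) + (lg s + c)).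
  apply: block_mod; rewrite -modnDml lgM // modnDml -addnA.
  by rewrite -modnDml lgX modnDml.
rewrite /block mulnC divnMDl //; set x := ((_ + c) %/ _)%N.
rewrite -{2}(@modn_small a p1) // -{2}(@modn_small b p1) // -(eqn_modDr b).
rewrite addnAC -addnA -addnA [(p1 - b + _)%N]addnA subnK.
  by rewrite eqn_modDl modnDl.
exact: ltnW.
Qed.

(** The fused class is split by the logarithm mod n: residue i contributes the period of index lg s
    + n k + i. *)
Let sum_label s k : s != 0 -> (k < p1)%N ->
  \sum_(x | label 0 x == k.+1 :> nat) psi (s * x)
    = window_sum eta n (lg s + n * k).
Proof.
move=> s0 lt_k; rewrite /window_sum.
pose r x : 'I_n := Ordinal (ltn_pmod (lg x) n_gt0).
rewrite (partition_big r predT) //=; apply: eq_bigr => i _.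
rewrite /eta [RHS](reindex_inj (mulfI s0)) /=; apply: eq_bigl => x.
rewrite label_eqS addn0 mulf_eq0 (negPf s0) /=; case: eqP => //= /eqP x0.
rewrite lgM // -addnA eqn_modDl N_E !modn_mull_split /block.
rewrite [(n * k)%N]mulnC divnMDl // modnMDl (divn_small (ltn_ord i)) addn0.
rewrite (modn_small (ltn_ord i)) (modn_small lt_k) -(inj_eq val_inj) /=.
apply/andP/eqP => [[/eqP -> /eqP ->] //|E].
have := congr1 (divn^~ n) E; have := congr1 (modn^~ n) E.
rewrite /= !modnMDl !divnMDl // modn_mod !(divn_small (ltn_pmod _ _)) //.
by rewrite (divn_small (ltn_ord i)) (modn_small (ltn_ord i)) !addn0 => -> ->.
Qed.

(** The window starts at lg s + n k, whose ceiling is k plus that of lg s / n. The label with offset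
    n - 1 records the latter mod p1, and periods depend only on the index mod N = n p1. *)
Let label_hat k s t : label n.-1 s = label n.-1 t ->
  \sum_(x | label 0 x == k) psi (s * x) = \sum_(x | label 0 x == k) psi (t * x).
Proof.
have [->|s0] := eqVneq s 0; have [->|t0] := eqVneq t 0 => // Est.
- by have := label_eq0 n.-1 t; rewrite -Est label_eq0 eqxx (negPf t0).
- by have := label_eq0 n.-1 s; rewrite Est label_eq0 eqxx (negPf s0).
have [->|k0] := eqVneq k ord0.
  under eq_bigl do rewrite label_eq0.
  under [RHS]eq_bigl do rewrite label_eq0.
  by rewrite !big_pred1_eq !mulr0.
case: k k0 => [[|k] lt_k] // _.
under eq_bigl do rewrite -(inj_eq val_inj) /=.
under [RHS]eq_bigl do rewrite -(inj_eq val_inj) /=.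
rewrite !sum_label // (window_sum_ceil n_gt0 eta_shift).
rewrite [RHS](window_sum_ceil n_gt0 eta_shift).
have ceilE a : ((a + n * k + n.-1) %/ n = k + (a + n.-1) %/ n)%N.
  by rewrite addnAC addnC mulnC divnMDl.
have : block (lg s + n.-1) = block (lg t + n.-1).
  have := label_eqS n.-1 s (block (lg s + n.-1)).
  by rewrite Est label_eqS s0 t0 eqxx => /eqP ->.
rewrite /block !ceilE => Eb; apply: eq_bigr => i _; apply: eta_mod.
apply/eqP; rewrite eqn_modDr N_E -!muln_modr; apply/eqP; congr (_ * _)%N.
by rewrite -modnDmr Eb modnDmr.
Qed.

Let fused_relE k x y :
  ((x, y) \in fused_rel gamma m (p1 := p1) k) = (label 0 (x - y) == k).
Proof.
case: k => [[|k] lt_k]; rewrite /fused_rel.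
  rewrite (_ : Ordinal lt_k = ord0); last exact: val_inj.
  rewrite label_eq0 subr_eq0 /=; apply/imsetP/eqP => [[z _ [-> ->]]//|->].
  by exists y.
rewrite /= inE /= -(inj_eq val_inj) /= label_eqS addn0; set z := x - y.
apply/bigcupP/andP => [[i _ /imsetP[v /lcosetP[w /cycleP[t ->] ->]] Ez]|[z0 /eqP Eb]].
  have {}Ez : z = h ^+ (i + k * n + N * t)%N.
    by rewrite Ez -expgM -expgD hX.
  rewrite Ez hX_neq0; split=> //; apply/eqP.
  transitivity (block (k * n + i)).
    by apply: block_mod; rewrite lgX addnC [(N * t)%N]mulnC modnMDl addnC.
  by rewrite /block divnMDl // (divn_small (ltn_ord i)) addn0 modn_small.
(* Conversely, lg z mod n selects the class in the union and lg z / N the power of gamma^N. *)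
pose i := Ordinal (ltn_pmod (lg z) n_gt0); exists i => //.
apply/imsetP; exists (gamma ^+ lg z)%g; last by rewrite -[LHS]/z {1}(lgK z0) hX.
apply/lcosetP; exists ((gamma ^+ N) ^+ (lg z %/ N))%g; first exact: mem_cycle.
rewrite -expgM -expgD; congr (_ ^+ _)%g.
rewrite {1}(divn_eq (lg z) N) addnC [(N * _)%N]mulnC; congr (_ + _)%N.
by rewrite N_E modn_mull_split -/(block _) Eb addnC.
Qed.

Hypotheses (psi0 : psi 0 = 1) (psiD : {morph psi : x y / x + y >-> x * y}).
Hypothesis psi_neq1 : exists x, psi x != 1.

Lemma fused_rel_pseudocyclic_scheme :
  association_scheme (fused_rel gamma m (p1 := p1)) /\
  pseudocyclic (fused_rel gamma m (p1 := p1)) C.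
Proof.
split.
  exact: (cayley_association_scheme psi0 psiD psi_neq1 fused_relE (label_eq0 0)
    (label_surj 0) (label_surj n.-1) (labelN 0) label_hat).
exact: (cayley_pseudocyclic psi0 psiD psi_neq1 fused_relE (label_eq0 n.-1)
  (label_surj 0) (label_surj n.-1) (labelN 0) label_hat (label_homogeneous n.-1)).
Qed.

End CyclotomicLabels.
Theorem theorem3p3 (C : numClosedFieldType) (p1 m N p f : nat)
  (p1_prime : prime p1) (p1_gt3 : 3 < p1) (p1_mod4 : p1 = 3 %[mod 4])
  (m_ge1 : 1 <= m) (N_def : N = p1 ^ m)
  (p_prime : prime p) (p_coprime : coprime p N)
  (f_def : f = mult_ord N p) (f_half : f = totient N %/ 2)
  (F : finFieldType) (card_F : #|F| = p ^ f)
  (gamma : {unit F}) (gamma_gen : generator [set: {unit F}] gamma) :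
  association_scheme (fused_rel gamma m (p1 := p1)) /\
  pseudocyclic (fused_rel gamma m (p1 := p1)) C.
Proof.
have [psi [psi0 psiD psi_neq1 psi_frob]] :=
  frobenius_invariant_character p_prime card_F C.
have p_char := card_finPcharP card_F p_prime.
have N_gt1 : 1 < N by rewrite N_def -(expn0 p1) ltn_exp2l // prime_gt1.
have ord_p : mult_ord N p = totient N %/ 2 by rewrite -f_def.
(* As f is the order of p modulo N, q = p^f is congruent to 1 mod N. *)
have N_dvd : N %| #|F|.-1.
  have q_gt0 : 0 < p ^ f by rewrite expn_gt0 prime_gt0.
  by rewrite card_F -subn1 -eqn_mod_dvd // f_def expn_mult_ord.
subst N; exact: (fused_rel_pseudocyclic_scheme p_char psi_frob p1_prime
  (ltnW p1_gt3) m_ge1 p_coprime ord_p N_dvd gamma_gen psi0 psiD psi_neq1).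
Qed.
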